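(* Under the MNL model, let $\bar S\in\mathcal{P}(\mathcal{L})$. The optimal objective $V_T^{\mathrm{Fluid}}(\bar S)$ of the fluid approximation does not converge to the optimal objective $V_T^*(\bar S)$ of the stochastic problem as $T\to\infty$. Moreover, $$\lim_{T\to\infty}V_T^{\mathrm{Fluid}}(\bar S)-V_T^*(\bar S)\ \ge\ -\frac{|\bar S|}{\beta_p}>0.$$
   Context: Items and options: $\mathcal{L}=\{1,\dots,L\}$ is a finite set of unique items; item $j$ has salvage value $\xi_j\in\mathbb{R}$. An option is a sequence of distinct items (a single item, or a bundle of two or more items); the salvage value $\xi_i$ of an option $i$ is the sum of the salvage values of its items. $\mathcal{O}$ is the set of all options with at most $K_b$ items, and $\mathcal{P}(\mathcal{L})$ is the collection of all sets $S\subseteq\mathcal{O}$ such that each item belongs to exactly one option of $S$ and $S$ contains at most $K_s$ bundles ($K_b,K_s$ given integers). Customers: $\Omega$ is a finite set of customer types; $X$ is a random type with probability mass function $p_X$ on $\Omega$, and $\mathbb{E}_X$ is expectation over $X$. In each of $T$ periods a customer arrives with probability $\mu\in(0,1]$ (fixed), with type distributed as $X$ independently across periods. Option $i$ has perceived quality $q_i^\omega\in\mathbb{R}$ for type $\omega$; the price sensitivity is $\beta_p<0$. MNL model: $\rho_i^\omega(p,S)=\dfrac{e^{q_i^\omega+\beta_pp_i}}{1+\sum_{j\in S}e^{q_j^\omega+\beta_pp_j}}$ for $i\in S$, $p\in\mathbb{R}^{|S|}$. Value function (stochastic problem): for every $S'$ contained in some member of $\mathcal{P}(\mathcal{L})$,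 $V_0^*(S')=\sum_{i\in S'}\xi_i$ and, for $t\ge1$, $V_t^*(S')=V_{t-1}^*(S')+\mu\,\mathbb{E}_X\big[R(\rho^X,S',\Delta V_t^*(S'))\big]$, where $\Delta_iV_t^*(S')=V^*_{t-1}(S')-V^*_{t-1}(S'\setminus\{i\})$ and $R(g,S',\Delta)=\max_{p\in\mathbb{R}^{|S'|}}\sum_{i\in S'}g_i(p,S')(p_i-\Delta_i)$. Fluid approximation: with $N=|\bar S|$, $V_T^{\mathrm{Fluid}}(\bar S)$ is the optimal objective value of $$\max_{\rho\in(0,1)^{N\times|\Omega|}}\ \mu T\sum_{i\in\bar S}\mathbb{E}_X\big[\rho_i^X(p_i^X(\rho^X)-\xi_i)\big]+\sum_{i\in\bar S}\xi_i\quad\text{s.t.}\quad\mathbb{E}_X[\rho_i^X]\le\frac1{\mu T}\ \ \forall i\in\bar S,\qquad\sum_{i\in\bar S}\rho_i^\omega\le1\ \ \forall\omega\in\Omega,$$ where $p_i^\omega(\rho^\omega)=\frac1{\beta_p}\big(\ln\rho_i^\omega-\ln\rho_0^\omega-q_i^\omega\big)$ with $\rho_0^\omega=1-\sum_{j\in\bar S}\rho_j^\omega$ is the MNL price vector inducing choice probabilities $\rho^\omega$. *)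

(* Defs.v *)
From HB Require Import structures.
From mathcomp Require Import all_boot all_order all_algebra.
From mathcomp Require Import all_classical all_reals all_analysis.

Set Implicit Arguments.
Unset Strict Implicit.
Unset Printing Implicit Defensive.

Import Order.TTheory GRing.Theory Num.Theory.

Local Open Scope ring_scope.

(* The set O of options: nonempty sequences of at most Kb distinct items. *)
Definition option_of (L Kb : nat) : Type :=
  {s : {bseq Kb of 'I_L} | (0 < size s)%N && uniq s}.
HB.instance Definition _ L Kb := Finite.on (option_of L Kb).

Definition items L Kb (i : option_of L Kb) : seq 'I_L := val i.

Definition is_bundle L Kb (i : option_of L Kb) : bool := (2 <= size (items i))%N.

(* The collection P(L). *)
Definition partitionings L Kb (Ks : nat) : {set {set option_of L Kb}} :=
  [set S : {set option_of L Kb} |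
    [forall j : 'I_L, #|[set i in S | j \in items i]| == 1%N]
    && (#|[set i in S | is_bundle i]| <= Ks)%N].

Definition salvage (R : realType) L Kb (xi : 'I_L -> R) (i : option_of L Kb) : R :=
  \sum_(j <- items i) xi j.

(* Vectors indexed by a set S of options are functions on all options of which
   only the coordinates in S are ever used. *)

Definition mnl (R : realType) (O : finType) (beta : R) (q : O -> R)
    (p : O -> R) (S : {set O}) (i : O) : R :=
  expR (q i + beta * p i) / (1 + \sum_(j in S) expR (q j + beta * p j)).

(* R(g, S, Delta); under the MNL model the supremum is a maximum. *)
Definition max_revenue (R : realType) (O : finType)
    (g : (O -> R) -> {set O} -> O -> R) (S : {set O}) (Delta : O -> R) : R :=
  sup (range (fun p : O -> R => \sum_(i in S) g p S i * (p i - Delta i))).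

Fixpoint Vstar (R : realType) L Kb (xi : 'I_L -> R) (Omega : finType)
    (pX : Omega -> R) (mu beta : R) (q : Omega -> option_of L Kb -> R)
    (t : nat) (S : {set option_of L Kb}) : R :=
  if t is t'.+1 then
    let V := Vstar xi pX mu beta q t' in
    V S + mu * \sum_(w : Omega)
      pX w * max_revenue (mnl beta (q w)) S (fun i => V S - V (S :\ i))
  else \sum_(i in S) salvage xi i.

Definition no_purchase (R : realType) (O : finType) (S : {set O}) (r : O -> R) : R :=
  1 - \sum_(j in S) r j.

(* Prices are extended reals because the constraint \sum_i r i <= 1 allows the
   no-purchase probability to vanish: then lne 0 = -oo makes the price -oo
   (whereas the real-valued ln 0 would be 0). *)
Definition mnl_price (R : realType) (O : finType) (beta : R) (q : O -> R)
    (S : {set O}) (r : O -> R) (i : O) : \bar R :=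
  ((beta^-1)%:E * (lne (r i)%:E - lne (no_purchase S r)%:E - (q i)%:E))%E.

Definition fluid_objective (R : realType) L Kb (xi : 'I_L -> R) (Omega : finType)
    (pX : Omega -> R) (mu beta : R) (q : Omega -> option_of L Kb -> R)
    (T : nat) (S : {set option_of L Kb}) (rho : Omega -> option_of L Kb -> R) :
    \bar R :=
  ((mu * T%:R)%:E *
     (\sum_(i in S) \sum_(w : Omega) (pX w)%:E *
        ((rho w i)%:E *
           (mnl_price beta (q w) S (rho w) i - (salvage xi i)%:E)))
   + (\sum_(i in S) salvage xi i)%R%:E)%E.

Definition fluid_feasible (R : realType) (O : finType) (Omega : finType)
    (pX : Omega -> R) (mu : R) (T : nat) (S : {set O}) (rho : Omega -> O -> R) :
    Prop :=
  [/\ forall w i, i \in S -> 0 < rho w i < 1,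
      forall i, i \in S -> \sum_(w : Omega) pX w * rho w i <= (mu * T%:R)^-1 &
      forall w, \sum_(i in S) rho w i <= 1].

Definition Vfluid (R : realType) L Kb (xi : 'I_L -> R) (Omega : finType)
    (pX : Omega -> R) (mu beta : R) (q : Omega -> option_of L Kb -> R)
    (T : nat) (S : {set option_of L Kb}) : \bar R :=
  ereal_sup [set fluid_objective xi pX mu beta q T S rho |
               rho in [set rho | fluid_feasible pX mu T S rho]]%classic.

(* Main.v *)
(** Put [b := - 1 / beta], [n := #|S|], [c_i := mu * E_X[exp (q_i^X - 1)]] and
    [Z_t S := exp (V_t S / b)].  Charging every option the markup [b], and
    bounding [x exp (- x)] by [1 / e], puts the optimal one-period revenue of
    type [w] between [b z / (1 + z)] and [b z], where [z] is the sum over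
    [i \in S] of [exp (q_i^w - 1 - Delta_i / b)].  To first order this
    linearizes the Bellman recursion:
    [Z_{t+1} S - Z_t S] is equivalent to [\sum_(i in S) c_i * Z_t (S :\ i)],
    provided [Z_t (S :\ i) / Z_t S] vanishes.  By induction on [n] and
    Stolz-Cesaro, [Z_t S / t ^ n] tends to [\prod_(i in S) c_i].

    For the fluid problem, dropping [ln rho_0 <= 0] and applying Gibbs'
    inequality gives, for large [T], the upper bound
    [b * \sum_(i in S) (ln E_X[exp q_i^X] + ln (mu T))], and the allocations
    [rho_i^w] proportional to [exp q_i^w] that saturate the capacity
    constraints attain it up to [o(1)].  Since [ln c_i] differs from
    [ln mu + ln E_X[exp q_i^X]] by exactly [1], the gap converges to [n * b]. *)

Require Import Defs.
From mathcomp Require Import all_boot all_order all_algebra.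
From mathcomp Require Import all_classical all_reals all_analysis.
From mathcomp Require Import ring lra.

Import Order.TTheory GRing.Theory Num.Theory.
Import numFieldNormedType.Exports.

Local Open Scope classical_set_scope.
Local Open Scope ring_scope.

(** * Limits of real sequences *)

Lemma ler_dist_div (R : realType) (l a b e : R) : 0 < b ->
  (`|l - a / b| <= e) = (`|a - l * b| <= e * b).
Proof.
move=> b_gt0; rewrite (_ : a - l * b = (a / b - l) * b); last first.
  by rewrite mulrBl divfK ?gt_eqF.
by rewrite normrM (gtr0_norm b_gt0) ler_pM2r// distrC.
Qed.

(** From some [t0] on, each increment of [a] is within [e / 2] of [l] in units of the increment of
    [b]. Telescoping keeps that bound for differences from [t0], and the error fixed at [t0] is
    absorbed by the other half of [e] because [b] is unbounded. *)
Lemma stolz_cesaro (R : realType) (a b : nat -> R) (l : R) :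
  (\forall t \near \oo, 0 < b t.+1 - b t) ->
  b t @[t --> \oo] --> +oo ->
  (a t.+1 - a t) / (b t.+1 - b t) @[t --> \oo] --> l ->
  a t / b t @[t --> \oo] --> l.
Proof.
move=> b_incr b_y /cvgrPdist_le ab_l; apply/cvgrPdist_le => e e_gt0.
have e2_gt0 : 0 < e / 2 by rewrite divr_gt0.
have [t0 _ t0P] : \forall t \near \oo,
    `|(a t.+1 - a t) - l * (b t.+1 - b t)| <= e / 2 * (b t.+1 - b t).
  near=> t.
  have db_gt0 : 0 < b t.+1 - b t by near: t.
  rewrite -ler_dist_div//.
  by near: t; exact: ab_l.
have dev t : (t0 <= t)%N ->
    `|(a t - a t0) - l * (b t - b t0)| <= e / 2 * (b t - b t0).
  elim: t => [|t IHt]; first by rewrite leqn0 => /eqP ->;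
    rewrite !subrr !mulr0 subrr normr0.
  rewrite leq_eqVlt => /predU1P[<-|]; first by rewrite !subrr !mulr0 subrr normr0.
  rewrite ltnS => tle; have := IHt tle; have := t0P t tle => /= H1 H2.
  rewrite (_ : _ - _ = ((a t.+1 - a t) - l * (b t.+1 - b t))
    + ((a t - a t0) - l * (b t - b t0))); last by ring.
  apply: le_trans (ler_normD _ _) _; apply: le_trans (lerD H1 H2) _.
  by rewrite -mulrDr; apply: ler_wpM2l; [exact: ltW | lra].
near=> t.
have bt_gt0 : 0 < b t.
  by near: t; move/cvgryPgt : b_y; exact.
have tt0 : (t0 <= t)%N by near: t; exact: nbhs_infty_ge.
have bt_big : (`|a t0 - l * b t0| + e / 2 * `|b t0|) / (e / 2) <= b t.
  by near: t; move/cvgryPge : b_y; exact.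
rewrite ler_dist_div//.
move: bt_big; rewrite ler_pdivrMr// => bt_big.
have := dev t tt0.
rewrite (_ : a t - l * b t = ((a t - a t0) - l * (b t - b t0)) + (a t0 - l * b t0));
  last by ring.
move=> H; apply: le_trans (ler_normD _ _) _.
have := ler_norm (- b t0); rewrite normrN => H2.
have : e / 2 * (- b t0) <= e / 2 * `|b t0| by rewrite ler_wpM2l// ltW.
lra.
Unshelve. all: by end_near. Qed.

Lemma cvgr_sum (R : realType) (T I : Type) (F : set_system T) (r : seq I)
    (P : pred I) (f : I -> T -> R) (l : I -> R) :
  Filter F -> (forall i, P i -> f i x @[x --> F] --> l i) ->
  \sum_(i <- r | P i) f i x @[x --> F] --> \sum_(i <- r | P i) l i.
Proof. by move=> FF; apply: cvg_big; exact: add_continuous. Qed.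

Lemma cvgrX (R : realType) (T : Type) (F : set_system T) (f : T -> R) (l : R)
    (n : nat) :
  Filter F -> f x @[x --> F] --> l -> f x ^+ n @[x --> F] --> l ^+ n.
Proof.
by move=> FF; apply: (@continuous_cvg _ _ _ _ _ f (fun x : R => x ^+ n));
  exact: exprn_continuous.
Qed.

Lemma cvg_invn (R : realType) : (t%:R : R)^-1 @[t --> \oo] --> (0 : R).
Proof.
apply/gtr0_cvgV0; last exact: cvgr_idn.
by near=> t; rewrite ltr0n; near: t; exact: nbhs_infty_gt.
Unshelve. all: by end_near. Qed.

(** Factoring the difference of powers and dividing by [t ^ k] leaves [k + 1] terms
    [(1 + 1 / t) ^ (k - i)], each tending to [1]. *)
Lemma cvg_powS_increment (R : realType) (k : nat) :
  ((t.+1)%:R ^+ k.+1 - t%:R ^+ k.+1) / t%:R ^+ k @[t --> \oo] --> (k.+1%:R : R).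
Proof.
have H : (\sum_(i < k.+1) (1 + (t%:R : R)^-1) ^+ (k - i)) @[t --> \oo] --> (k.+1%:R : R).
  have -> : (k.+1%:R : R) = \sum_(i < k.+1) 1 by rewrite sumr_const card_ord.
  apply: cvgr_sum => i _.
  have := @cvgrX _ _ _ (fun t => 1 + (t%:R : R)^-1) (1 + 0) (k - i) eventually_filter.
  rewrite addr0 expr1n; apply.
  rewrite -[X in _ --> X]addr0.
  by apply: cvgD; [exact: cvg_cst | exact: cvg_invn].
apply: cvg_trans H; apply: near_eq_cvg; near=> t.
have t_gt0 : 0 < t%:R :> R by rewrite ltr0n; near: t; exact: nbhs_infty_gt.
rewrite subrXX -[X in X - _]natr1 addrAC subrr add0r mul1r mulr_suml.
apply: eq_bigr => i _ /=.
have ik : (i <= k)%N by rewrite -ltnS.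
have -> : (t%:R : R) ^+ k = t%:R ^+ (k - i) * t%:R ^+ i by rewrite -exprD subnK.
rewrite invfM mulrACA divff ?mulr1 ?expf_neq0 ?gt_eqF//.
by rewrite -expr_div_n; congr (_ ^+ _); rewrite -natr1 mulrDl divff ?gt_eqF// mul1r.
Unshelve. all: by end_near. Qed.

(** For [y > 0] the left side is [1 / (1 / y + M / x)], which is nondecreasing in both variables;
    cross-multiplying also covers [y = 0]. *)
Lemma ler_harmonic (R : realType) (M x y z w : R) :
  0 <= M -> 0 < x -> 0 <= y -> x <= z -> y <= w ->
  x * y / (x + M * y) <= z * w / (z + M * w).
Proof.
move=> M_ge0 x_gt0 y_ge0 xz yw.
have z_gt0 := lt_le_trans x_gt0 xz; have w_ge0 := le_trans y_ge0 yw.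
have My := mulr_ge0 M_ge0 y_ge0; have Mw := mulr_ge0 M_ge0 w_ge0.
rewrite ler_pdivrMr ?ltr_wpDr// mulrAC ler_pdivlMr ?ltr_wpDr//.
rewrite -subr_ge0 (_ : _ - _ = z * x * (w - y) + M * y * w * (z - x)); last by ring.
by rewrite addr_ge0// ?mulr_ge0// ?subr_ge0// ltW.
Qed.

(** A priori growth, needed before [B t / Z t] can be shown to vanish. The increment is
    nondecreasing in [Z t] and [B t], so for small [kappa] and large [t] the sequence
    [kappa * t ^ k.+1] is a subsolution of the recursion. *)
Lemma pow_lower_bound (R : realType) (k : nat) (Z B : nat -> R) (M c : R) :
  0 <= M -> 0 < c -> (forall t, 0 < Z t) ->
  (\forall t \near \oo, c * t%:R ^+ k <= B t) ->
  (forall t, Z t + Z t * B t / (Z t + M * B t) <= Z t.+1) ->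
  exists2 kappa : R, 0 < kappa & \forall t \near \oo, kappa * t%:R ^+ k.+1 <= Z t.
Proof.
move=> M_ge0 c_gt0 Z_gt0 B_ge Z_step.
have := @cvg_powS_increment R k => /cvgrPdist_le /(_ 1 ltr01) pow_incr.
set K : R := k.+1%:R + 1.
have K_gt0 : 0 < K by rewrite ltr_wpDl.
have Ky : (t%:R : R) @[t --> \oo] --> +oo by exact: cvgr_idn.
have [N _ NP] : \forall t \near \oo, [/\ c * t%:R ^+ k <= B t,
    (t.+1)%:R ^+ k.+1 - t%:R ^+ k.+1 <= K * t%:R ^+ k,
    2 * K * M <= t%:R & 0 < (t%:R : R)].
  near=> t.
  have t_gt0 : 0 < t%:R :> R by rewrite ltr0n; near: t; exact: nbhs_infty_gt.
  split => //; [by near: t| |by near: t; move/cvgryPge : Ky; exact].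
  rewrite -ler_pdivrMr ?exprn_gt0//.
  have : `|k.+1%:R - ((t.+1)%:R ^+ k.+1 - t%:R ^+ k.+1) / t%:R ^+ k| <= 1 :> R by near: t.
  by rewrite ler_distlC => /andP[].
have N_gt0 : 0 < (N%:R : R) by have [] := NP N (leqnn N).
(* The first bound closes the induction step, the second starts the induction at [N]. *)
pose kappa := Num.min (c / (2 * K)) (Z N / N%:R ^+ k.+1).
have kappa_gt0 : 0 < kappa.
  by rewrite lt_min !divr_gt0// ?mulr_gt0// exprn_gt0.
have kappaK : 2 * K * kappa <= c.
  by rewrite mulrC -ler_pdivlMr ?mulr_gt0// /kappa ge_min lexx.
exists kappa => //; exists N => // t /=.
elim: t => [|t IHt].
  by rewrite leqn0 => /eqP N0; rewrite N0 ltxx in N_gt0.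
rewrite leq_eqVlt => /predU1P[<-|].
  by rewrite -ler_pdivlMr ?exprn_gt0// /kappa ge_min lexx orbT.
rewrite ltnS => Nt; have {IHt} IH := IHt Nt; have [cB incr t_big t_gt0] := NP t Nt.
have tk_gt0 : 0 < (t%:R : R) ^+ k by rewrite exprn_gt0.
apply: le_trans (Z_step t).
apply: (@le_trans _ _ (kappa * t%:R ^+ k.+1 + kappa * (K * t%:R ^+ k))).
  by rewrite -mulrDr ler_wpM2l ?(ltW kappa_gt0)//; lra.
apply: lerD => //.
have x_gt0 : 0 < kappa * (t%:R : R) ^+ k.+1 by rewrite mulr_gt0// exprn_gt0.
have y_gt0 : 0 < c * (t%:R : R) ^+ k by rewrite mulr_gt0// exprn_gt0.
apply: le_trans (ler_harmonic _ _ _ _ _ _ M_ge0 x_gt0 (ltW y_gt0) IH cB).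
rewrite ler_pdivlMr ?ltr_wpDr ?mulr_ge0// ?(ltW y_gt0) ?(ltW c_gt0) ?(ltW tk_gt0)//.
rewrite exprS.
rewrite (_ : _ * (_ + _) = kappa * t%:R ^+ k * t%:R ^+ k * (K * (kappa * t%:R + M * c))); last by ring.
rewrite (_ : _ * (_ * _) * (_ * _) = kappa * t%:R ^+ k * t%:R ^+ k * (t%:R * c));
  last by ring.
apply: ler_wpM2l; first by rewrite !mulr_ge0// ltW.
(* After cancellation the goal is [K * (kappa * t + M * c) <= t * c]; each of the two bounds below
   pays for half of it. *)
have : 2 * K * kappa * t%:R <= c * t%:R by rewrite ler_wpM2r// ltW.
have : 2 * K * M * c <= t%:R * c by rewrite ler_wpM2r// ltW.
lra.
Unshelve. all: by end_near. Qed.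

(** Here [d] is the increment of [ln Z]. Its two bounds agree to first order once [B t / Z t]
    vanishes, so [Z t.+1 - Z t] is equivalent to [B t], and Stolz-Cesaro against [t ^ k.+1] divides
    the limit of [B t / t ^ k] by [k.+1]. *)
Lemma pow_asymptotics (R : realType) (k : nat) (Z B d : nat -> R) (M P : R) :
  0 <= M -> 0 < P -> (forall t, 0 < Z t) -> (forall t, 0 <= B t) ->
  B t / t%:R ^+ k @[t --> \oo] --> k.+1%:R * P ->
  (forall t, Z t.+1 = Z t * expR (d t)) ->
  (forall t, B t / (Z t + M * B t) <= d t <= B t / Z t) ->
  Z t / t%:R ^+ k.+1 @[t --> \oo] --> P.
Proof.
move=> M_ge0 P_gt0 Z_gt0 B_ge0 B_l Z_rec d_bounds.
have t_gt0 : \forall t \near \oo, 0 < (t%:R : R).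
  by near=> t; rewrite ltr0n; near: t; exact: nbhs_infty_gt.
have ZB_gt0 t : 0 < Z t + M * B t by rewrite ltr_wpDr// mulr_ge0.
have Z_step t : Z t + Z t * B t / (Z t + M * B t) <= Z t.+1.
  rewrite Z_rec -[X in X + _]mulr1 -mulrA -mulrDr ler_pM2l//.
  apply: le_trans (expR_ge1Dx _); rewrite lerD2l.
  by have /andP[] := d_bounds t.
have kP_gt0 : 0 < k.+1%:R * P by rewrite mulr_gt0.
have [kappa kappa_gt0 Z_ge] : exists2 kappa : R, 0 < kappa &
    \forall t \near \oo, kappa * t%:R ^+ k.+1 <= Z t.
  apply: (@pow_lower_bound _ _ _ B _ (k.+1%:R * P / 2) M_ge0) => //.
    by rewrite divr_gt0.
  near=> t; have tgt0 : 0 < (t%:R : R) by near: t.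
  rewrite -ler_pdivlMr ?exprn_gt0//; near: t.
  by apply: (cvgr_ge _ B_l); lra.
have r0 : B t / Z t @[t --> \oo] --> (0 : R).
  have H : (B t / t%:R ^+ k) * (kappa^-1 * t%:R^-1) @[t --> \oo] --> (0 : R).
    rewrite -[X in _ --> X](mulr0 (k.+1%:R * P)); apply: cvgM => //.
    rewrite -[X in _ --> X](mulr0 kappa^-1); apply: cvgM;
      [exact: cvg_cst|exact: cvg_invn].
  apply: squeeze_cvgr (cvg_cst 0) H; near=> t.
  have tgt0 : 0 < (t%:R : R) by near: t.
  rewrite divr_ge0 ?(ltW (Z_gt0 _))//=.
  rewrite -invfM -mulrA -invfM ler_wpM2l// lef_pV2 ?posrE// ?mulr_gt0 ?exprn_gt0//.
  by rewrite mulrCA -exprSr; near: t.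
apply: stolz_cesaro.
- near=> t; rewrite subr_gt0 ltrXn2r// ?ler0n// ltr_nat//.
- apply/cvgryPge => A; near=> t.
  have t_ge1 : 1 <= (t%:R : R) by rewrite ler1n; near: t; exact: nbhs_infty_gt.
  apply: (@le_trans _ _ (t%:R : R)).
    by near: t; move: A; apply/cvgryPge; exact: cvgr_idn.
  by rewrite -[X in X <= _]expr1 ler_weXn2l.
have dZ : (Z t.+1 - Z t) / t%:R ^+ k @[t --> \oo] --> k.+1%:R * P.
  have lo : (B t / t%:R ^+ k) / (1 + M * (B t / Z t)) @[t --> \oo] --> k.+1%:R * P.
    have den1 : 1 + M * (B t / Z t) @[t --> \oo] --> (1 : R).
      have := cvgD (cvg_cst (1 : R)) (cvgM (cvg_cst M) r0).
      by rewrite mulr0 addr0; apply.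
    have := cvgM B_l (cvgV (oner_neq0 _) den1).
    by rewrite invr1 mulr1; apply.
  have hi : (B t / t%:R ^+ k) * expR (B t / Z t) @[t --> \oo] --> k.+1%:R * P.
    have er : expR (B t / Z t) @[t --> \oo] --> expR (0 : R).
      by apply: continuous_cvg r0; exact: continuous_expR.
    by have := cvgM B_l er; rewrite expR0 mulr1; apply.
  apply: squeeze_cvgr lo hi; near=> t.
  have tgt0 : 0 < (t%:R : R) by near: t.
  have tk_gt0 : 0 < (t%:R : R) ^+ k by rewrite exprn_gt0.
  have /andP[d_lo d_hi] := d_bounds t; have Zt := Z_gt0 t.
  have -> : B t / t%:R ^+ k / (1 + M * (B t / Z t)) =
      Z t * (B t / (Z t + M * B t)) / t%:R ^+ k.
    by field; rewrite !gt_eqF//=.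
  have -> : B t / t%:R ^+ k * expR (B t / Z t) =
      Z t * (B t / Z t * expR (B t / Z t)) / t%:R ^+ k.
    by field; rewrite !gt_eqF.
  rewrite Z_rec -[X in _ - X]mulr1 -mulrBr !ler_pM2r ?invr_gt0// !ler_pM2l//.
  apply/andP; split.
    by have := expR_ge1Dx (d t); lra.
  have d_ge0 : 0 <= d t by apply: le_trans d_lo; rewrite divr_ge0// ltW.
  apply: (@le_trans _ _ (d t * expR (d t))).
    (* Multiplying [1 - d <= exp (- d)] by [exp d] gives [exp d - 1 <= d * exp d]. *)
    have := expR_ge1Dx (- d t); rewrite -(ler_pM2r (expR_gt0 (d t))) mulrDl mul1r.
    by rewrite [expR (- _) * _]mulrC expRxMexpNx_1; lra.
  by apply: ler_pM; rewrite ?expR_ge0 ?ler_expR.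
have -> : P = (k.+1%:R * P) / k.+1%:R by field.
have H := @cvg_powS_increment R k.
have {H} := cvgM dZ (cvgV (lt0r_neq0 (ltr0Sn R k)) H).
move=> /(_ _ _); apply: cvg_trans; apply: near_eq_cvg; near=> t.
have tgt0 : 0 < (t%:R : R) by near: t.
by rewrite /= invf_div mulrA divfK ?expf_neq0 ?gt_eqF.
Unshelve. all: by end_near. Qed.

(** * The stochastic problem *)

Lemma max_revenue_mnl_bounds (R : realType) (O : finType) (beta : R) (q : O -> R)
    (S : {set O}) (Delta : O -> R) :
  beta < 0 ->
  let z := \sum_(i in S) expR (q i - 1 + beta * Delta i) in
  [/\ z / (1 + z) <= - beta * max_revenue (mnl beta q) S Delta &
      - beta * max_revenue (mnl beta q) S Delta <= z].
Proof.
move=> beta_lt0 z.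
have b_gt0 : 0 < - beta by rewrite oppr_gt0.
have bE : (- beta)^-1 * - beta = 1 by rewrite mulVf ?gt_eqF.
have z_ge0 : 0 <= z by apply: sumr_ge0 => i _; exact: expR_ge0.
pose revenue (p : O -> R) := \sum_(i in S) mnl beta q p S i * (p i - Delta i).
have ub p : revenue p <= (- beta)^-1 * z.
  set D := 1 + \sum_(j in S) expR (q j + beta * p j).
  have D_ge1 : 1 <= D by rewrite lerDl sumr_ge0// => i _; exact: expR_ge0.
  have D_gt0 : 0 < D by apply: lt_le_trans D_ge1.
  apply: (@le_trans _ _ ((- beta)^-1 * z / D)); last first.
    by rewrite ler_pdivrMr// ler_peMr// mulr_ge0// invr_ge0 ltW.
  rewrite mulr_sumr mulr_suml; apply: ler_sum => i _.
  rewrite /mnl -/D mulrAC ler_pM2r ?invr_gt0//.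
  (* This is [x <= exp (x - 1)] at the scaled margin [x = - beta * (p i - Delta i)]. *)
  have := expR_ge1Dx (- beta * (p i - Delta i) - 1).
  rewrite addrC subrK => /(ler_wpM2l (expR_ge0 (q i + beta * p i))).
  rewrite -expRD mulrCA => H; rewrite -(ler_pM2l b_gt0).
  apply: le_trans H _; rewrite mulrA mulfV ?gt_eqF// mul1r ler_expR.
  lra.
(* Without an upper bound [sup] would be a default value. *)
have sup_ub : has_ubound (range revenue) by exists ((- beta)^-1 * z) => _ [p _ <-].
split; last first.
  rewrite -ler_pdivlMl//; apply: ge_sup; last by move=> _ [p _ <-]; exact: ub.
  by exists (revenue Delta), Delta.
rewrite -ler_pdivrMl//.
(* At the uniform markup [(- beta)^-1] the revenue is exactly [(- beta)^-1 * (z / (1 + z))]. *)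
apply: ub_le_sup => //; exists (fun i => Delta i + (- beta)^-1) => //.
have eE i : q i + beta * (Delta i + (- beta)^-1) = q i - 1 + beta * Delta i.
  by field; rewrite lt_eqF.
under eq_bigr do rewrite /mnl eE [_ + _ - _]addrAC subrr add0r.
rewrite -mulr_suml -mulr_suml mulrC; congr (_ * (_ / (1 + _))).
by apply: eq_bigr => i _; rewrite eE.
Qed.

(** Trades the denominator [1 + z i] of each type for a common one in the mean [r]: where [a i > 0],
    [a i * z i <= r] gives [z i <= (a i)^-1 * r], and the sum of the inverses dominates each of
    them. It supplies the constant [M] of [pow_asymptotics]. *)
Lemma sum_weighted_harmonic_ge (R : realType) (I : finType) (a z : I -> R) :
  (forall i, 0 <= a i) -> (forall i, 0 <= z i) ->
  forall r, r = \sum_i a i * z i ->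
  r / (1 + (\sum_i (a i)^-1) * r) <= \sum_i a i * (z i / (1 + z i)).
Proof.
move=> a_ge0 z_ge0 r rE; rewrite {1}rE mulr_suml; apply: ler_sum => i _.
have r_ge0 : 0 <= r by rewrite rE sumr_ge0// => j _; rewrite mulr_ge0.
rewrite -mulrA; have [->|ai_neq0] := eqVneq (a i) 0; first by rewrite !mul0r.
have ai_gt0 : 0 < a i by rewrite lt_def ai_neq0 a_ge0.
have M_ge0 : 0 <= \sum_i (a i)^-1 by apply: sumr_ge0 => j _; rewrite invr_ge0.
rewrite ler_wpM2l// ler_wpM2l// lef_pV2 ?posrE ?ltr_wpDr ?mulr_ge0// lerD2l.
rewrite -[z i](mulKf ai_neq0); apply: ler_pM; rewrite ?invr_ge0 ?mulr_ge0//.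
  by rewrite (bigD1 i)//= lerDl sumr_ge0// => j _; rewrite invr_ge0.
by rewrite rE (bigD1 i)//= lerDl sumr_ge0// => j _; rewrite mulr_ge0.
Qed.

Lemma expectation_gt0 (R : realType) (I : finType) (p f : I -> R) :
  (forall i, 0 <= p i) -> \sum_i p i = 1 -> (forall i, 0 < f i) ->
  0 < \sum_i p i * f i.
Proof.
move=> p_ge0 p_sum1 f_gt0; have pf_ge0 i : 0 <= p i * f i by rewrite mulr_ge0// ltW.
rewrite lt_def sumr_ge0// andbT; apply/eqP => /psumr_eq0P pf0.
have := @oner_neq0 R; rewrite -p_sum1 big1 ?eqxx// => i _.
by have /eqP := pf0 (fun i _ => pf_ge0 i) i isT;
  rewrite mulf_eq0 (gt_eqF (f_gt0 i)) orbF => /eqP.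
Qed.

(** The [- 1] in the exponent is [beta] times the markup [(- beta)^-1]. *)
Definition demand_rate (R : realType) (O Omega : finType) (pX : Omega -> R) (mu : R)
    (q : Omega -> O -> R) (i : O) : R :=
  mu * \sum_(w : Omega) pX w * expR (q w i - 1).

Arguments demand_rate {R O Omega} pX mu q i.

Lemma Vstar_set0 (R : realType) L Kb (xi : 'I_L -> R) (Omega : finType)
    (pX : Omega -> R) (mu beta : R) (q : Omega -> option_of L Kb -> R) (t : nat) :
  Vstar xi pX mu beta q t finset.set0 = 0.
Proof.
elim: t => [|t IHt] /=; first by rewrite big_set0.
rewrite IHt add0r big1 ?mulr0// => w _; rewrite /max_revenue.
set E := (X in sup X); suff -> : E = [set 0] by rewrite sup1 mulr0.
apply/seteqP; split => [_ [p _ <-]|_ ->] /=.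
  by rewrite big_set0.
by exists (fun=> 0) => //; rewrite big_set0.
Qed.

Lemma Vstar_asymptotics (R : realType) L Kb (xi : 'I_L -> R) (Omega : finType)
    (pX : Omega -> R) (mu beta : R) (q : Omega -> option_of L Kb -> R)
    (S : {set option_of L Kb}) :
  (forall w, 0 <= pX w) -> \sum_(w : Omega) pX w = 1 -> 0 < mu -> beta < 0 ->
  expR (- beta * Vstar xi pX mu beta q t S) / t%:R ^+ #|S| @[t --> \oo] -->
    \prod_(i in S) demand_rate pX mu q i.
Proof.
move=> pX_ge0 pX_sum1 mu_gt0 beta_lt0.
pose c := demand_rate pX mu q.
have c_gt0 i : 0 < c i.
  by rewrite mulr_gt0// expectation_gt0// => w; exact: expR_gt0.
pose V := Vstar xi pX mu beta q.
pose Z t S := expR (- beta * V t S).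
have [k] := ubnP #|S|; elim: k S => // k IHk S.
have [->|S_neq0] := eqVneq S finset.set0.
  move=> _; rewrite big_set0 cards0;
    under eq_cvg do rewrite Vstar_set0 mulr0 expR0 expr0 divr1.
  exact: cvg_cst.
rewrite -card_gt0 in S_neq0; rewrite ltnS => Sk.
have SD1 i : i \in S -> #|S :\ i| = #|S|.-1.
  by move=> iS; rewrite (cardsD1 i S) iS.
rewrite -(prednK S_neq0).
have nu_ge0 w : 0 <= mu * pX w by rewrite mulr_ge0// ltW.
pose z t w := \sum_(i in S) expR (q w i - 1 + beta * (V t S - V t (S :\ i))).
have z_ge0 t w : 0 <= z t w by apply: sumr_ge0 => i _; exact: expR_ge0.
pose B t := \sum_(i in S) c i * Z t (S :\ i).
(* [Z t (S :\ i) / Z t S] is the exponential of [beta] times the marginal value of [i]. *)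
have rE t : B t / Z t S = \sum_w mu * pX w * z t w.
  under [RHS]eq_bigr do rewrite mulr_sumr.
  rewrite exchange_big mulr_suml; apply: eq_bigr => i _ /=.
  rewrite /c /demand_rate mulr_sumr 2!mulr_suml; apply: eq_bigr => w _.
  rewrite /Z -mulrA -expRB -!mulrA -expRD; congr (_ * (_ * expR _)); ring.
pose d t := \sum_w mu * pX w * (- beta *
  max_revenue (mnl beta (q w)) S (fun i => V t S - V t (S :\ i))).
apply: (@pow_asymptotics _ _ _ B d (\sum_w (mu * pX w)^-1)).
- by apply: sumr_ge0 => w _; rewrite invr_ge0.
- exact: prodr_gt0.
- by move=> t; exact: expR_gt0.
- by move=> t; apply: sumr_ge0 => i _; rewrite mulr_ge0 ?expR_ge0// ltW.
- rewrite prednK//; under eq_cvg do rewrite mulr_suml.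
  (* Each of the [#|S|] copies of the full product is split at a different option [i], to match the
     induction hypothesis for [S :\ i]. *)
  rewrite (_ : _ * _ = \sum_(i in S) c i * \prod_(j in S :\ i) c j); last first.
    rewrite mulr_natl -sumr_const; apply: eq_bigr => i iS.
    by rewrite (big_setD1 i).
  apply: cvgr_sum => i iS; under eq_cvg do rewrite -mulrA.
  apply: cvgM; first exact: cvg_cst.
  rewrite -(SD1 i iS); apply: IHk; rewrite SD1//.
  by rewrite -ltnS prednK.
- move=> t; rewrite -expRD /= -/V; congr expR; rewrite mulrDr; congr (_ + _).
  rewrite mulrCA !mulr_sumr; apply: eq_bigr => w _; rewrite -/(V t); ring.
- move=> t; apply/andP; split.
    have Z_gt0 : 0 < Z t S by exact: expR_gt0.
    set M := \sum_w _.
    have ZB_gt0 : 0 < Z t S + M * B t.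
      by rewrite ltr_wpDr// mulr_ge0// sumr_ge0// => [w|i] _;
        rewrite ?invr_ge0// mulr_ge0 ?expR_ge0// ltW.
    have -> : B t / (Z t S + M * B t) = B t / Z t S / (1 + M * (B t / Z t S)).
      by field; rewrite !gt_eqF.
    rewrite rE;
      apply: le_trans (sum_weighted_harmonic_ge _ _ _ _ nu_ge0 (z_ge0 t) _ erefl) _.
    apply: ler_sum => w _; rewrite ler_wpM2l//.
    by have [] := max_revenue_mnl_bounds _ _ _ (q w) S (fun i => V t S - V t (S :\ i)) beta_lt0.
  rewrite rE; apply: ler_sum => w _; rewrite ler_wpM2l//.
  by have [] := max_revenue_mnl_bounds _ _ _ (q w) S (fun i => V t S - V t (S :\ i)) beta_lt0.
Qed.

(** * The fluid approximation *)

(** Lagrangian relaxation of the capacity constraint: with [K = ln E + ln m], its multiplier is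
    [b * (K - 1 - b^-1 * xi)], and the relaxed profit is maximal pointwise at
    [exp (q w) / E / m]. *)
Lemma entropy_profit_le (R : realType) (Omega : finType) (p q rho : Omega -> R)
    (b m xi : R) :
  (forall w, 0 <= p w) -> \sum_w p w = 1 -> 0 < b -> 0 < m ->
  (forall w, 0 < rho w) -> \sum_w p w * rho w <= m^-1 ->
  forall E, E = \sum_w p w * expR (q w) ->
  1 + b^-1 * xi <= ln E + ln m ->
  m * (\sum_w p w * (rho w * (b * (q w - ln (rho w)) - xi))) + xi
    <= b * (ln E + ln m).
Proof.
move=> p_ge0 p_sum1 b_gt0 m_gt0 rho_gt0 rho_cap E EE m_big.
have E_gt0 : 0 < E by rewrite EE expectation_gt0// => w; exact: expR_gt0.
set K := ln E + ln m in m_big *.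
have term w : rho w * (b * (q w - ln (rho w)) - xi) <=
    b * ((K - 1 - b^-1 * xi) * rho w + expR (q w) / E / m).
  (* concavity of ln at the optimal allocation y: ln (y / rho) <= y / rho - 1 *)
  set y := expR (q w) / E / m.
  have y_gt0 : 0 < y by rewrite !divr_gt0// expR_gt0.
  have lny : ln y = q w - K.
    by rewrite /y !ln_div ?posrE ?divr_gt0 ?expR_gt0// expRK opprD addrA.
  have y_rho : 0 < y / rho w by rewrite divr_gt0.
  have ln_le : ln (y / rho w) <= y / rho w - 1.
    by rewrite -{1}(subrK 1 (y / rho w)) addrC; apply: le_ln1Dx; lra.
  move: ln_le; rewrite ln_div ?posrE// lny.
  have r_neq0 : rho w != 0 by rewrite gt_eqF.
  have -> : b * ((K - 1 - b^-1 * xi) * rho w + y) = rho w * (b * (K + (y / rho w - 1)) - xi).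
    by field; rewrite r_neq0 gt_eqF.
  move: (y / rho w) => v ln_le; rewrite ler_pM2l// lerD2r ler_pM2l//; lra.
have sum_le : \sum_w p w * (rho w * (b * (q w - ln (rho w)) - xi)) <=
    b * ((K - 1 - b^-1 * xi) * \sum_w p w * rho w + m^-1).
  have -> : m^-1 = \sum_w p w * (expR (q w) / E / m).
    under eq_bigr do rewrite !mulrA.
    by rewrite -!mulr_suml -EE divff ?mul1r// gt_eqF.
  rewrite mulr_sumr -big_split mulr_sumr; apply: ler_sum => w _ /=.
  by apply: le_trans (ler_wpM2l (p_ge0 w) (term w)) _; rewrite le_eqVlt; apply/orP;
    left; apply/eqP; ring.
(* The multiplier is nonnegative by [m_big], so the expected consumption may be raised to the
   capacity [m^-1]. *)
have cap : b * ((K - 1 - b^-1 * xi) * \sum_w p w * rho w + m^-1) <=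
    b * ((K - 1 - b^-1 * xi) * m^-1 + m^-1).
  by rewrite ler_pM2l// lerD2r ler_wpM2l//; lra.
have := ler_wpM2l (ltW m_gt0) (le_trans sum_le cap).
rewrite -(lerD2r xi) => H; apply: le_trans H _.
rewrite le_eqVlt; apply/orP; left; apply/eqP; field.
by rewrite !gt_eqF.
Qed.

(** The no-purchase probability is at most [1], so its logarithm only lowers the price; when it is
    not positive, the price is [-oo] and the bound is trivial. *)
Lemma mnl_price_le (R : realType) (O : finType) (beta : R) (q : O -> R)
    (S : {set O}) (r : O -> R) (i : O) :
  beta < 0 -> (forall j, j \in S -> 0 < r j) -> i \in S ->
  (mnl_price beta q S r i <= ((- beta)^-1 * (q i - ln (r i)))%:E)%E.
Proof.
move=> beta_lt0 r_gt0 iS; rewrite /mnl_price (lne_EFin (r_gt0 i iS)).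
have b_lt0 : beta^-1 < 0 by rewrite invr_lt0.
have np_le1 : no_purchase S r <= 1.
  by rewrite gerBl sumr_ge0// => j jS; rewrite ltW// r_gt0.
have [np_gt0|np_le0] := ltP 0 (no_purchase S r).
  rewrite lne_EFin// -!EFinB -EFinM lee_fin invrN mulNr -mulrN.
  by rewrite ler_nM2l//; have := ln_le0 np_le1; lra.
by rewrite le0_lneNy ?lee_fin// -[(- -oo)%E]/(+oo%E) addey// addye//
  lt0_muley ?lte_fin// leNye.
Qed.

Lemma mnl_price_interior (R : realType) (O : finType) (beta : R) (q : O -> R)
    (S : {set O}) (r : O -> R) (i : O) :
  0 < r i -> 0 < no_purchase S r ->
  mnl_price beta q S r i =
    ((- beta)^-1 * (q i - ln (r i) + ln (no_purchase S r)))%:E.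
Proof.
move=> ri np; rewrite /mnl_price !lne_EFin// -!EFinB -EFinM invrN.
by congr EFin; ring.
Qed.

Definition mean_weight (R : realType) (O Omega : finType) (pX : Omega -> R)
    (q : Omega -> O -> R) (i : O) : R := \sum_(w : Omega) pX w * expR (q w i).

Arguments mean_weight {R O Omega} pX q i.

(** Without the no-purchase term the objective separates over options, and [entropy_profit_le]
    applies to each. The last hypothesis makes the capacity multipliers nonnegative, as happens for
    large [T]. *)
Lemma Vfluid_le (R : realType) L Kb (xi : 'I_L -> R) (Omega : finType)
    (pX : Omega -> R) (mu beta : R) (q : Omega -> option_of L Kb -> R)
    (T : nat) (S : {set option_of L Kb}) :
  (forall w, 0 <= pX w) -> \sum_(w : Omega) pX w = 1 -> beta < 0 ->
  0 < mu * T%:R ->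
  (forall i, i \in S ->
     1 - beta * salvage xi i <= ln (mean_weight pX q i) + ln (mu * T%:R)) ->
  (Vfluid xi pX mu beta q T S <=
     ((- beta)^-1 * \sum_(i in S) (ln (mean_weight pX q i) + ln (mu * T%:R)))%:E)%E.
Proof.
move=> pX_ge0 pX_sum1 beta_lt0 m_gt0 m_big;
  apply: ge_ereal_sup => _ [rho [rho01 cap _] <-].
have rho_gt0 w i : i \in S -> 0 < rho w i by move=> /(rho01 w) /andP[].
rewrite /fluid_objective.
apply: (@le_trans _ _ ((mu * T%:R) * (\sum_(i in S) \sum_w pX w *
   (rho w i * ((- beta)^-1 * (q w i - ln (rho w i)) - salvage xi i)))
   + \sum_(i in S) salvage xi i)%:E).
  rewrite EFinD leeD2r// [leRHS]EFinM lee_pmul2l ?lte_fin// -[leRHS]sumEFin;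
    apply: lee_sum => i iS.
  rewrite -[leRHS]sumEFin; apply: lee_sum => w _; rewrite EFinM lee_wpmul2l ?lee_fin//.
  rewrite EFinM lee_pmul2l ?lte_fin ?rho_gt0// EFinB leeB//.
  by apply: mnl_price_le => // j jS; exact: rho_gt0.
rewrite lee_fin mulr_sumr -big_split mulr_sumr; apply: ler_sum => i iS /=.
apply: entropy_profit_le => //; first by rewrite invr_gt0 oppr_gt0.
- by move=> w; exact: rho_gt0.
- exact: cap.
- by rewrite invrK mulNr; exact: m_big.
Qed.

(** Divided by [mu * T], this bounds the total purchase probability of every type under the
    allocation of [Vfluid_ge]; the sum over types stands in for a maximum. *)
Definition weight_bound (R : realType) (O Omega : finType) (pX : Omega -> R)
    (q : Omega -> O -> R) (S : {set O}) : R :=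
  \sum_(w : Omega) \sum_(i in S) expR (q w i) / mean_weight pX q i.

Arguments weight_bound {R O Omega} pX q S.

Lemma Vfluid_ge (R : realType) L Kb (xi : 'I_L -> R) (Omega : finType)
    (pX : Omega -> R) (mu beta : R) (q : Omega -> option_of L Kb -> R)
    (T : nat) (S : {set option_of L Kb}) :
  (forall w, 0 <= pX w) -> \sum_(w : Omega) pX w = 1 -> beta < 0 ->
  0 < mu * T%:R -> weight_bound pX q S < mu * T%:R ->
  (((- beta)^-1 * \sum_(i in S) (ln (mean_weight pX q i) + ln (mu * T%:R) +
        ln (1 - weight_bound pX q S / (mu * T%:R))))%:E
     <= Vfluid xi pX mu beta q T S)%E.
Proof.
move=> pX_ge0 pX_sum1 beta_lt0; set m := mu * T%:R; set G := weight_bound pX q S.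
move=> m_gt0 Gm.
have E_gt0 i : 0 < mean_weight pX q i by apply: expectation_gt0 => // w;
  exact: expR_gt0.
have b_gt0 : 0 < (- beta)^-1 by rewrite invr_gt0 oppr_gt0.
(* Equality case of the entropy bound: apart from the no-purchase term, the induced price of [i] is
   the same for all types. *)
pose rho w i := expR (q w i) / mean_weight pX q i / m.
have rho_gt0 w i : 0 < rho w i by rewrite !divr_gt0// expR_gt0.
have Gm_lt1 : G / m < 1 by rewrite ltr_pdivrMr// mul1r.
have rho_sum w : \sum_(i in S) rho w i <= G / m.
  rewrite -mulr_suml ler_pM2r ?invr_gt0// /G /weight_bound (bigD1 w)//= lerDl.
  by apply: sumr_ge0 => w' _; apply: sumr_ge0 => i _; rewrite divr_ge0 ?expR_ge0// ltW.
have cap i : \sum_w pX w * rho w i = m^-1.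
  under eq_bigr do rewrite !mulrA.
  by rewrite -!mulr_suml divff ?mul1r// gt_eqF// E_gt0.
have rho_feasible : fluid_feasible pX mu T S rho.
  split => [w i iS|i iS|w].
  - rewrite rho_gt0 (le_lt_trans _ Gm_lt1)//; apply: le_trans (rho_sum w).
    by rewrite (bigD1 i)//= lerDl sumr_ge0// => j _; rewrite ltW.
  - by rewrite cap.
  - exact: le_trans (rho_sum w) (ltW Gm_lt1).
apply: le_trans (ereal_sup_ubound _); last by exists rho.
have np_ge w : 1 - G / m <= no_purchase S (rho w) by rewrite lerD2l lerN2.
have np_gt0 w : 0 < no_purchase S (rho w) by apply: lt_le_trans (np_ge w);
  rewrite subr_gt0.
have -> : fluid_objective xi pX mu beta q T S rho =
  (m * (\sum_(i in S) \sum_w pX w * (rho w i * ((- beta)^-1 *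
     (q w i - ln (rho w i) + ln (no_purchase S (rho w))) - salvage xi i)))
   + \sum_(i in S) salvage xi i)%:E.
  rewrite /fluid_objective [RHS]EFinD [X in _ = (X + _)%E]EFinM.
  rewrite -[X in _ = (_ * X + _)%E]sumEFin; congr (_ * _ + _)%E.
  apply: eq_bigr => i iS; rewrite -[RHS]sumEFin; apply: eq_bigr => w _.
  by rewrite mnl_price_interior// EFinM [in RHS]EFinM EFinB.
rewrite lee_fin 2!mulr_sumr -big_split; apply: ler_sum => i iS /=.
(* Saturation makes [m] times the mean of [rho] equal to [1], so a price constant in [w] passes
   under the expectation and the salvage value cancels. *)
have -> : (- beta)^-1 * (ln (mean_weight pX q i) + ln m + ln (1 - G / m)) =
  m * (\sum_w pX w * rho w i * ((- beta)^-1 * (ln (mean_weight pX q i) + ln m +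
      ln (1 - G / m)) - salvage xi i)) + salvage xi i.
  rewrite -mulr_suml cap mulrA divff ?mul1r ?subrK// gt_eqF//.
rewrite lerD2r ler_pM2l//; apply: ler_sum => w _; rewrite -mulrA ler_wpM2l//.
rewrite ler_pM2l// lerD2r ler_pM2l//.
have -> : ln (rho w i) = q w i - ln (mean_weight pX q i) - ln m.
  by rewrite !ln_div ?posrE ?divr_gt0 ?expR_gt0// expRK.
have : ln (1 - G / m) <= ln (no_purchase S (rho w)).
  by rewrite ler_ln ?posrE// subr_gt0.
lra.
Qed.

(** * The gap *)

Lemma partitionings_card_gt0 (L Kb Ks : nat) (S : {set option_of L Kb}) :
  (0 < L)%N -> S \in partitionings L Kb Ks -> (0 < #|S|)%N.
Proof.
move=> L_gt0; rewrite inE => /andP[/forallP /(_ (Ordinal L_gt0)) /eqP card1 _].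
rewrite card_gt0; apply/eqP => S0.
have : (#|[set i in S | Ordinal L_gt0 \in items i]| <= #|S|)%N.
  by apply/subset_leq_card/fintype.subsetP => i; rewrite inE => /andP[].
by rewrite card1 S0 cards0.
Qed.

Lemma ln_prod (R : realType) (I : Type) (r : seq I) (P : pred I) (f : I -> R) :
  (forall i, P i -> 0 < f i) ->
  ln (\prod_(i <- r | P i) f i) = \sum_(i <- r | P i) ln (f i).
Proof.
move=> f_gt0; apply: expR_inj; rewrite expR_sum lnK; last first.
  by rewrite posrE prodr_gt0.
by apply: eq_bigr => i Pi; rewrite lnK ?posrE ?f_gt0.
Qed.

(** This [- 1] is the only discrepancy with the fluid rate; contributed once per option, it makes up
    the whole gap. *)
Lemma ln_demand_rate (R : realType) (O Omega : finType) (pX : Omega -> R) (mu : R)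
    (q : Omega -> O -> R) (i : O) :
  0 < mu -> 0 < mean_weight pX q i ->
  ln (demand_rate pX mu q i) = ln mu + ln (mean_weight pX q i) - 1.
Proof.
move=> mu_gt0 E_gt0.
have -> : demand_rate pX mu q i = mu * (mean_weight pX q i * expR (- 1)).
  rewrite /demand_rate /mean_weight mulr_suml; congr (_ * _).
  by apply: eq_bigr => w _; rewrite expRD mulrA.
by rewrite !lnM ?posrE ?mulr_gt0 ?expR_gt0// expRK addrA.
Qed.

Theorem mainTheorem7 (R : realType) (L Kb Ks : nat) (L_gt0 : (0 < L)%N)
    (xi : 'I_L -> R)
    (Omega : finType) (pX : Omega -> R)
    (pX_ge0 : forall w, 0 <= pX w) (pX_sum1 : \sum_(w : Omega) pX w = 1)
    (mu : R) (mu_gt0 : 0 < mu) (mu_le1 : mu <= 1)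
    (q : Omega -> option_of L Kb -> R)
    (beta : R) (beta_lt0 : beta < 0)
    (Sbar : {set option_of L Kb}) (Sbar_part : Sbar \in partitionings L Kb Ks) :
  let gap (T : nat) : \bar R :=
    (Vfluid xi pX mu beta q T Sbar - (Vstar xi pX mu beta q T Sbar)%:E)%E in
  [/\ ~ (gap T @[T --> \oo] --> (0 : \bar R)%E),
      exists2 l : R, gap T @[T --> \oo] --> l%:E & - (#|Sbar|%:R / beta) <= l &
      0 < - (#|Sbar|%:R / beta)].
Proof.
move=> gap; set l := - (#|Sbar|%:R / beta).
have beta_neq0 : beta != 0 by rewrite lt_eqF.
have l_gt0 : 0 < l.
  rewrite /l -mulrN -invrN divr_gt0 ?oppr_gt0// ltr0n.
  exact: partitionings_card_gt0 Sbar_part.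
have E_gt0 i : 0 < mean_weight pX q i by apply: expectation_gt0 => // w;
  exact: expR_gt0.
have c_gt0 i : 0 < demand_rate pX mu q i.
  by rewrite mulr_gt0// expectation_gt0// => w; exact: expR_gt0.
pose P := \prod_(i in Sbar) demand_rate pX mu q i.
have P_gt0 : 0 < P by exact: prodr_gt0.
have lnP : ln P = \sum_(i in Sbar) (ln mu + ln (mean_weight pX q i)) - #|Sbar|%:R.
  rewrite ln_prod// -sumr_const -sumrB; apply: eq_bigr => i _.
  by rewrite ln_demand_rate.
pose V T := Vstar xi pX mu beta q T Sbar.
pose x T := ln (expR (- beta * V T) / T%:R ^+ #|Sbar|).
have x_cvg : x T @[T --> \oo] --> ln P.
  apply: continuous_cvg; first exact: continuous_ln.
  exact: Vstar_asymptotics.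
have T_gt0 : \forall T \near \oo, 0 < (T%:R : R).
  by near=> T; rewrite ltr0n; near: T; exact: nbhs_infty_gt.
(* The [ln T] terms cancel: the fluid bound has one per option, and [x] is normalized by
   [T ^ #|Sbar|]. *)
have upperE : \forall T \near \oo,
    (- beta)^-1 * \sum_(i in Sbar) (ln (mean_weight pX q i) + ln (mu * T%:R)) - V T =
    (- beta)^-1 * (ln P - x T) + l.
  near=> T; have Tgt0 : 0 < (T%:R : R) by near: T.
  rewrite /x ln_div ?posrE ?exprn_gt0 ?expR_gt0// expRK lnXn// lnP.
  under eq_bigr do rewrite lnM ?posrE// addrA [ln (mean_weight _ _ _) + _]addrC.
  rewrite big_split /= sumr_const -[ln _ *+ _]mulr_natl /l.
  by field; rewrite beta_neq0.
(* Bound from [Vfluid_ge] on the effect of the no-purchase term, summed over the options. *)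
pose corr T := (- beta)^-1 *
  (#|Sbar|%:R * ln (1 - weight_bound pX q Sbar / (mu * T%:R))).
have mT_y : mu * T%:R @[T --> \oo] --> +oo.
  apply/cvgryPge => A; near=> T; rewrite -ler_pdivrMl//; near: T.
  by move: (mu^-1 * A); apply/cvgryPge; exact: cvgr_idn.
have corr0 : corr T @[T --> \oo] --> (0 : R).
  have ratio0 : weight_bound pX q Sbar / (mu * T%:R) @[T --> \oo] --> (0 : R).
    have inv0 : (mu * T%:R)^-1 @[T --> \oo] --> (0 : R).
      by apply/gtr0_cvgV0 => //; near=> T; rewrite mulr_gt0//; near: T.
    by have := cvgM (cvg_cst (weight_bound pX q Sbar)) inv0; rewrite mulr0; apply.
  have sub1 : 1 - weight_bound pX q Sbar / (mu * T%:R) @[T --> \oo] --> (1 : R).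
    by have := cvgB (cvg_cst (1 : R)) ratio0; rewrite subr0; apply.
  have ln0 : ln (1 - weight_bound pX q Sbar / (mu * T%:R)) @[T --> \oo] --> (0 : R).
    by rewrite -(@ln1 R); apply: continuous_cvg sub1; exact: continuous_ln.
  have := cvgM (cvg_cst (- beta)^-1) (cvgM (cvg_cst (#|Sbar|%:R : R)) ln0).
  by rewrite !mulr0; apply.
have upper_cvg : (- beta)^-1 * (ln P - x T) + l @[T --> \oo] --> l.
  have := cvgD (cvgM (cvg_cst (- beta)^-1) (cvgB (cvg_cst (ln P)) x_cvg)) (cvg_cst l).
  by rewrite subrr mulr0 add0r; apply.
have lower_cvg : (- beta)^-1 * (ln P - x T) + l + corr T @[T --> \oo] --> l.
  by have := cvgD upper_cvg corr0; rewrite addr0; apply.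
(* Once [mu * T >= exp A], the hypothesis of [Vfluid_le] holds for all options at once. *)
pose A := \sum_(i in Sbar) `|1 - beta * salvage xi i - ln (mean_weight pX q i)|.
have gap_cvg : gap T @[T --> \oo] --> l%:E.
  apply: (@squeeze_cvge _ _ _ _ (fun T => ((- beta)^-1 * (ln P - x T) + l + corr T)%:E)
     _ (fun T => ((- beta)^-1 * (ln P - x T) + l)%:E)); last 2 first.
  - by apply: cvg_EFin lower_cvg; apply: nearW.
  - by apply: cvg_EFin upper_cvg; apply: nearW.
  near=> T; have Tgt0 : 0 < (T%:R : R) by near: T.
  have m_gt0 : 0 < mu * T%:R by rewrite mulr_gt0.
  rewrite -(near upperE T)//; apply/andP; split.
    rewrite addrAC EFinB leeB// /corr -mulrDr mulr_natl -sumr_const -big_split.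
    apply: Vfluid_ge => //; near: T.
    by move/cvgryPgt : mT_y; exact.
  rewrite EFinB leeB//; apply: Vfluid_le => // i iS.
  rewrite -lerBlDl; apply: (@le_trans _ _ A).
    by apply: le_trans (ler_norm _) _; rewrite /A (bigD1 i)//= lerDl sumr_ge0.
  rewrite -(expRK A) ler_ln ?posrE ?expR_gt0//.
  by near: T; move/cvgryPge : mT_y; exact.
split => //; last by exists l.
by move=> /(cvg_unique (@ereal_hausdorff R) gap_cvg) [] l0; rewrite l0 ltxx in l_gt0.
Unshelve. all: by end_near. Qed.
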